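(* For every integer $k\ge 4$, $$s(k)\le \left\lceil \tfrac{5}{2}k\right\rceil-3.$$
   Context: The off-diagonal Ramsey number $r_k(s,n)$ is the minimum $N$ such that every red-blue coloring of the $k$-element subsets of an $N$-element set contains a red $s$-set (a set of size $s$ all of whose $k$-element subsets are red) or a blue $n$-set (a set of size $n$ all of whose $k$-element subsets are blue). The tower function $t_k(x)$ is defined by $t_1(x)=x$ and $t_{i+1}(x)=2^{t_i(x)}$. For $k\ge 4$, $s(k)$ denotes the minimum $s$ for which $r_k(s,n)$ grows at least as a tower function of height $k-1$ in $n$, i.e. for which there is a constant $c>0$ (which may depend on $k$ and $s$) such that $r_k(s,n)\ge t_{k-1}(cn)$ for all sufficiently large $n$. *)

(* Defs.v *)
From mathcomp Require Import all_boot all_order all_algebra.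
From mathcomp Require Import reals exp.

Set Implicit Arguments.
Unset Strict Implicit.
Unset Printing Implicit Defensive.

Import Order.TTheory GRing.Theory Num.Theory.

(* A colouring is a function on all finite sets, [true] being red and [false]
   blue; only its values on the [k]-element sets are ever looked at. *)
Definition monochromatic (T : finType) (k : nat) (chi : {ffun {set T} -> bool})
    (b : bool) (S : {set T}) : bool :=
  [forall e : {set T}, (e \subset S) && (#|e| == k) ==> (chi e == b)].

Definition ramsey_prop (k s n N : nat) : bool :=
  [forall chi : {ffun {set 'I_N} -> bool},
     [exists S : {set 'I_N}, (#|S| == s) && monochromatic k chi true S]
  || [exists S : {set 'I_N}, (#|S| == n) && monochromatic k chi false S]].

Lemma ramsey_sets (k s n : nat) : exists N, forall (T : finType) (A : {set T})
    (chi : {set T} -> bool), N <= #|A| ->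
  exists b (S : {set T}), [/\ S \subset A, #|S| = (if b then s else n) &
    forall e : {set T}, e \subset S -> #|e| = k -> chi e = b].
Proof.
elim: k s n => [|k IHk] s n.
  exists (maxn s n) => T A chi; rewrite geq_max => /andP[hs hn].
  have /card_geqP[l [ul sl lA]] : (if chi set0 then s else n) <= #|A|
    by case: ifP.
  exists (chi set0), [set x in l]; split.
  - by apply/subsetP => x; rewrite inE; apply: lA.
  - by rewrite cardsE (card_uniqP ul).
  - by move=> e _ /cards0_eq ->.
have [m] := ubnP (s + n); elim: m s n => // m IHm [|s] [|n] hm.
1,2,3: exists 0 => T A chi _.
- exists true, set0; rewrite sub0set cards0; split=> // e.
  by rewrite subset0 => /eqP ->; rewrite cards0.
- exists true, set0; rewrite sub0set cards0; split=> // e.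
  by rewrite subset0 => /eqP ->; rewrite cards0.
- exists false, set0; rewrite sub0set cards0; split=> // e.
  by rewrite subset0 => /eqP ->; rewrite cards0.
have [|N1 h1] := IHm s n.+1; first by rewrite addSn in hm.
have [|N2 h2] := IHm s.+1 n; first by rewrite addnS in hm.
have [N hN] := IHk N1 N2; exists N.+1 => T A chi hA.
have /card_gt0P[x xA] : 0 < #|A| by apply: leq_trans hA.
have hA' : N <= #|A :\ x| by move: hA; rewrite (cardsD1 x A) xA.
have [c [S' [S'A cS' mS']]] := hN _ _ (fun e => chi (x |: e)) hA'.
have : exists b (S : {set T}), [/\ S \subset S',
    #|S| = (if b then s.+1 - c else n.+1 - ~~ c) &
    forall e : {set T}, e \subset S -> #|e| = k.+1 -> chi e = b].
  case: c cS' {mS'} => cS'.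
    have [|b [S [? ? ?]]] := h1 _ S' chi; first by rewrite cS'.
    by exists b, S; rewrite subn1 subn0.
  have [|b [S [? ? ?]]] := h2 _ S' chi; first by rewrite cS'.
  by exists b, S; rewrite subn1 subn0.
case=> b [S [SS' cS mS]]; have SA' := subset_trans SS' S'A.
have SA : S \subset A by apply: subset_trans SA' (subsetDl _ _).
have xS : x \notin S.
  by apply/negP => /(subsetP SA'); rewrite !inE eqxx.
have [bc|bc] := eqVneq b c; last first.
  exists b, S; split=> //.
  by rewrite cS; case: (b) (c) bc => [] [] //=; rewrite subn0.
subst c; exists b, (x |: S); split.
- by rewrite subUset sub1set xA.
- by rewrite cardsU1 xS cS; case: (b); rewrite subSS subn0.
- move=> e eS ce; have [xe|xe] := boolP (x \in e).
    rewrite -(setD1K xe); apply: mS'.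
      by apply: subset_trans SS'; rewrite subDset.
    by move: ce; rewrite (cardsD1 x e) xe => -[].
  apply: mS ce; apply/subsetP => y ye.
  have := subsetP eS y ye; rewrite !inE => /orP[/eqP yx|//].
  by rewrite -yx ye in xe.
Qed.

Lemma ramsey_exists (k s n : nat) : exists N, ramsey_prop k s n N.
Proof.
have [N hN] := ramsey_sets k s n; exists N; apply/forallP => chi.
have [|b [S [_ cS mS]]] := hN _ [set: 'I_N] chi; first by rewrite cardsT card_ord.
have mono : monochromatic k chi b S.
  by apply/forallP => e; apply/implyP => /andP[eS /eqP ce]; rewrite (mS e).
apply/orP; case: b cS mono {mS} => cS mono; [left|right];
  by apply/existsP; exists S; rewrite cS eqxx.
Qed.

Definition ramsey (k s n : nat) : nat := ex_minn (ramsey_exists k s n).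

Local Open Scope ring_scope.

(* [tower 1 x = x] and [tower i.+1 x = 2 `^ tower i x] for [1 <= i];
   [tower 0] is a junk value. *)
Definition tower (R : realType) (i : nat) (x : R) : R :=
  iter i.-1 (fun y => 2 `^ y) x.

Definition tower_growth (R : realType) (k s : nat) : Prop :=
  exists2 c : R, 0 < c &
    exists n0 : nat, forall n : nat, (n0 <= n)%N ->
      tower k.-1 (c * n%:R) <= (ramsey k s n)%:R.

(* [m] is s(k), the least [s] for which r_k(s, n) grows at least as a tower of
   height [k - 1]. *)
Definition is_min_tower_growth (R : realType) (k m : nat) : Prop :=
  tower_growth R k m /\ forall s : nat, tower_growth R k s -> (m <= s)%N.

(* Main.v *)
Require Import Defs.
From mathcomp Require Import all_boot all_order all_algebra.
From mathcomp Require Import reals.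
From mathcomp Require Import zify lra boolp exp.

Set Implicit Arguments.
Unset Strict Implicit.
Unset Printing Implicit Defensive.

Import Order.TTheory GRing.Theory Num.Theory.

(* The stronger bound s(k) <= k + 3 holds (Mubayi and Suk).  Given a 4-colouring
   chi of the (k-1)-sets of {0, ..., N-1}, colour v_1 < ... < v_k red iff
   chi(v_1, ..., v_(k-1)) < chi(v_2, ..., v_k).  A red (k+3)-set contains a tight
   path along which chi takes 5 increasing values; along a blue set of size 4n,
   chi is non-increasing, so one of 4 consecutive blocks of size n is
   monochromatic.  Hence r_k(k+3, 4n) is at least the 4-colour Ramsey number of n
   in uniformity k - 1, and the Erdos-Hajnal stepping-up construction, started
   from a random 2-colouring of the edges of a complete graph, bounds the latter
   from below by a tower of height k - 1. *)

(** * Highest differing bits *)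

Lemma delta_subproof (u v : nat) : exists e, u %/ 2 ^ e.+1 == v %/ 2 ^ e.+1.
Proof.
have h w : w <= u + v -> w %/ 2 ^ (u + v).+1 = 0.
  move=> le_w; rewrite divn_small//.
  by apply: leq_ltn_trans le_w (ltn_trans (ltnSn _) _); apply: ltn_expl.
by exists (u + v); rewrite !h ?leq_addl ?leq_addr.
Qed.

(* For [u <> v], the position of the highest bit in which they differ. *)
Definition delta (u v : nat) : nat := ex_minn (delta_subproof u v).

Lemma delta_le u v e : (delta u v <= e) = (u %/ 2 ^ e.+1 == v %/ 2 ^ e.+1).
Proof.
rewrite /delta; case: ex_minnP => d /eqP huv dmin.
apply/idP/idP => [le_de|]; last exact: dmin.
by rewrite -(subnKC le_de) -addSn expnD !divnMA huv.
Qed.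

Lemma delta_lt u v N : 0 < N -> u < 2 ^ N -> v < 2 ^ N -> delta u v < N.
Proof. by case: N => // N _ hu hv; rewrite ltnS delta_le !divn_small. Qed.

(** If [u] and [w] agree above some bit, then so does [v], squeezed between them. *)
Lemma delta_max u v w : u <= v <= w ->
  delta u w = maxn (delta u v) (delta v w).
Proof.
move=> /andP[uv vw]; apply/eqP; rewrite eqn_leq geq_max; apply/andP; split.
  rewrite delta_le; set e := maxn _ _.
  have : delta u v <= e by rewrite leq_maxl.
  have : delta v w <= e by rewrite leq_maxr.
  by rewrite !delta_le => /eqP <- /eqP ->.
have : delta u w <= delta u w by [].
rewrite !delta_le; set e := (delta u w).+1 => /eqP euw.
have h1 := leq_div2r (2 ^ e) uv; have h2 := leq_div2r (2 ^ e) vw.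
by apply/andP; split; rewrite eqn_leq ?h1 ?h2 -?euw ?h2// euw ?h1.
Qed.

(** Were both equal to [d], the quotients by [2 ^ d] would be three increasing integers with the
    same half rounded down, but only two integers share a half. *)
Lemma delta_neq u v w : u < v -> v < w -> delta u v != delta v w.
Proof.
move=> uv vw; apply/eqP => duv; set d := delta u v in duv.
have top x y : delta x y = d -> x %/ 2 ^ d %/ 2 = y %/ 2 ^ d %/ 2.
  by move=> h; apply/eqP; rewrite -!divnMA -expnSr -delta_le h.
have bot x y : x < y -> delta x y = d -> x %/ 2 ^ d < y %/ 2 ^ d.
  move=> xy h; rewrite ltn_neqAle leq_div2r ?andbT; last exact: ltnW.
  case: d h {duv top} => [_|e h]; first by rewrite !divn1 ltn_eqF.
  by rewrite -delta_le h ltnn.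
have := top u v erefl; have := top v w (esym duv).
have := bot u v uv erefl; have := bot v w vw (esym duv).
lia.
Qed.

(** * Sequences of deltas and their subsequences *)

Definition deltas (s : seq nat) : seq nat :=
  if s is v :: s' then pairmap delta v s' else [::].

Lemma size_deltas s : size (deltas s) = (size s).-1.
Proof. by case: s => //= v s; rewrite size_pairmap. Qed.

Lemma nth_deltas s i : i.+1 < size s ->
  nth 0 (deltas s) i = delta (nth 0 s i) (nth 0 s i.+1).
Proof. by case: s => //= v s; rewrite ltnS => hi; rewrite (nth_pairmap 0). Qed.

Lemma deltas_take_drop s i j :
  deltas (take j.+1 (drop i s)) = take j (drop i (deltas s)).
Proof.
elim: i s => [|i IHi] [|v s] //=.
  rewrite !drop0; elim: s v j => [|w s IHs] v [|j] //=.
  by rewrite IHs.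
by rewrite IHi; case: s => //=.
Qed.

Lemma deltas_lt s N : 0 < N -> all (fun x => x < 2 ^ N) s ->
  all (fun x => x < N) (deltas s).
Proof.
move=> N0; case: s => //= v s; elim: s v => //= w s IHs v /and3P[hv hw hs].
by rewrite delta_lt//= IHs// hw.
Qed.

Lemma deltas_neq s i : sorted ltn s -> i.+2 < size s ->
  nth 0 (deltas s) i != nth 0 (deltas s) i.+1.
Proof.
move=> /(sortedP 0) ss hi; rewrite !nth_deltas//; last exact: ltnW.
by apply: delta_neq; apply: ss => //; apply: ltnW.
Qed.

(* Keep the first vertex, and the upper endpoint of each selected delta. *)
Lemma deltas_mask_inc v s m : path ltn v s -> sorted ltn (pairmap delta v s) ->
  pairmap delta v (mask m s) = mask m (pairmap delta v s).
Proof.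
elim: s v m => [|w s IHs] v [|b m] //= /andP[vw ps] pd.
have sd : sorted ltn (pairmap delta w s) by apply: path_sorted pd.
have IH := IHs w m ps sd.
case: b => /=; first by rewrite IH.
have : subseq (mask m s) s by apply: mask_subseq.
case E : (mask m s) IH => [|y t] /= IH st; first exact: IH.
rewrite -IH; congr cons.
have ys : y \in s by apply: (mem_subseq st); rewrite mem_head.
have wy : w < y by move/(order_path_min ltn_trans)/allP: ps => /(_ y ys).
rewrite (@delta_max v w y); last by rewrite (ltnW vw) (ltnW wy).
apply/maxn_idPr/ltnW.
move/(order_path_min ltn_trans)/allP: pd; apply.
by apply: (mem_subseq (mask_subseq m _)); rewrite -IH mem_head.
Qed.

(* Keep the lower endpoint of each selected delta, and the last vertex. *)
Lemma deltas_mask_dec v s m : path ltn v s -> sorted gtn (pairmap delta v s) ->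
  size m = size s ->
  deltas (rcons (mask m (belast v s)) (last v s)) = mask m (pairmap delta v s).
Proof.
elim: s v m => [|w s IHs] v [|b m] //= /andP[vw ps] pd [sm].
have sd : sorted gtn (pairmap delta w s) by apply: path_sorted pd.
have IH := IHs w m ps sd sm.
case: b => //=; rewrite -IH.
have le_d y : y \in w :: s -> delta v y <= delta v w.
  rewrite inE => /predU1P[-> //|ys].
  have : all (fun x => x < delta v w) (pairmap delta w s).
    by apply: order_path_min pd => x y' z xy' yz; apply: ltn_trans xy'.
  have : delta v w <= delta v w by [].
  rewrite !delta_le => /eqP ->; move: (delta v w) => B.
  elim: s w ys {vw ps pd sd IH IHs sm} => //= x s IHs w.
  rewrite inE => ys /andP[/ltnW]; rewrite delta_le => /eqP-> hs.
  by case/predU1P: ys => [->//|ys]; apply: IHs.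
have : {subset rcons (mask m (belast w s)) (last w s) <= w :: s}.
  apply/allP; rewrite all_rcons; apply/andP; split; first exact: mem_last.
  by apply/allP => y /mem_mask; apply: mem_belast.
case E : (rcons _ _) => [|y t] /=; first by case: (mask _ _) E.
move=> /(_ y); rewrite mem_head => /(_ isT) ys; congr cons.
apply/eqP; rewrite eqn_leq le_d//=.
have wy : w <= y.
  move: ys; rewrite inE => /predU1P[-> //|ys].
  by move/(order_path_min ltn_trans)/allP: ps => /(_ y ys)/ltnW.
by rewrite (@delta_max v w y) ?leq_maxl// (ltnW vw).
Qed.

(** Lifts a [k]-tuple of deltas back to [k + 1] vertices, which is how a colouring of [k]-sets
    controls one of sets of size [k + 1]. *)
Lemma subseq_deltas s t : sorted ltn s -> t != [::] ->
  sorted ltn (deltas s) || sorted gtn (deltas s) -> subseq t (deltas s) ->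
  exists u, [/\ subseq u s, size u = (size t).+1 & deltas u = t].
Proof.
move=> ss t0 mono /subseqP[m].
case: s ss mono => [|v s] ps mono; first by rewrite mask0 => _ te; rewrite te in t0.
rewrite size_deltas => sm te; case/orP: mono => [inc|dec].
  exists (v :: mask m s); split; first by rewrite /= eqxx mask_subseq.
    by rewrite te /= !size_mask// size_pairmap.
  by rewrite te /= deltas_mask_inc.
exists (rcons (mask m (belast v s)) (last v s)); split.
- by rewrite lastI -!cats1 cat_subseq// mask_subseq.
- by rewrite te size_rcons !size_mask//= ?size_pairmap// size_belast.
- by rewrite te deltas_mask_dec.
Qed.

(** * Stepping up *)

(* A set of vertices is encoded by its increasing enumeration, so [chi] is only
   ever looked at on increasing sequences of length [k]. *)
Definition ramsey_free (k q N n : nat) (chi : seq nat -> nat) : Prop :=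
  (forall t, chi t < q) /\
  forall s c, sorted ltn s -> all (fun x => x < N) s -> n <= size s ->
    exists t, [/\ subseq t s, size t = k & chi t <> c].

Lemma ramsey_free_inc k q N n chi s c :
    0 < k -> 0 < N -> ramsey_free k q N n chi ->
    sorted ltn s -> all (fun x => x < 2 ^ N) s -> n < size s ->
    sorted ltn (deltas s) ->
  exists u, [/\ subseq u s, size u = k.+1, sorted ltn (deltas u) &
    chi (deltas u) <> c].
Proof.
move=> k0 N0 [_ free] ss sN ns inc.
have [|t [td tk ct]] := free _ c inc (deltas_lt N0 sN).
  by rewrite size_deltas; lia.
have t0 : t != [::] by rewrite -size_eq0 tk -lt0n.
have [|u [us uk ut]] := subseq_deltas ss t0 _ td; first by rewrite inc.
exists u; rewrite uk tk ut; split=> //.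
exact: (subseq_sorted ltn_trans td).
Qed.

(** [chi] is constrained on increasing sequences only, so decreasing deltas are reversed before it
    is applied. *)
Lemma ramsey_free_dec k q N n chi s c :
    0 < k -> 0 < N -> ramsey_free k q N n chi ->
    sorted ltn s -> all (fun x => x < 2 ^ N) s -> n < size s ->
    sorted gtn (deltas s) ->
  exists u, [/\ subseq u s, size u = k.+1, sorted gtn (deltas u) &
    chi (rev (deltas u)) <> c].
Proof.
move=> k0 N0 [_ free] ss sN ns dec.
have [|||t [td tk ct]] := free (rev (deltas s)) c.
- by rewrite rev_sorted.
- by rewrite all_rev deltas_lt.
- by rewrite size_rev size_deltas; lia.
have {}td : subseq (rev t) (deltas s) by rewrite -[deltas s]revK subseq_rev.
have t0 : rev t != [::] by rewrite -size_eq0 size_rev tk -lt0n.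
have [|u [us uk ut]] := subseq_deltas ss t0 _ td; first by rewrite dec orbT.
exists u; rewrite uk size_rev tk ut revK; split=> //.
by apply: subseq_sorted td dec => x y z xy yz; apply: ltn_trans xy.
Qed.

Lemma size_window (s : seq nat) k i : i + k <= size s ->
  size (take k (drop i s)) = k.
Proof. by move=> h; rewrite size_takel// size_drop; lia. Qed.

Lemma subseq_window (T : eqType) (s : seq T) k i : subseq (take k (drop i s)) s.
Proof. exact: subseq_trans (take_subseq _ _) (drop_subseq _ _). Qed.

Lemma nth_window (s : seq nat) k i j : j < k ->
  nth 0 (take k (drop i s)) j = nth 0 s (i + j).
Proof. by move=> jk; rewrite nth_take// nth_drop. Qed.

(* The extra factor 2 in the number of colours records whether the two deltas
   of a triple increase or decrease. *)
Lemma ramsey_free_step2 q N n chi : 0 < N -> ramsey_free 2 q N n chi ->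
  exists phi, ramsey_free 3 (2 * q) (2 ^ N) n.+1 phi.
Proof.
move=> N0 free; have [chiq _] := free.
pose phi s := let d := deltas s in
  if sorted ltn d then chi d else q + chi (rev d).
exists phi; split=> [t|s c ss sN ns].
  rewrite /phi /= mul2n -addnn; case: ifP => _; first exact/ltn_addr/chiq.
  by rewrite ltn_add2l chiq.
apply: contrapT => /forallNP mono.
have {}mono u : subseq u s -> size u = 3 -> phi u = c.
  by move=> us u3; apply: contrapT => uc; apply: (mono u).
have color i : i.+2 < size s -> phi (take 3 (drop i s)) = c.
  move=> hi; apply: mono; first exact: subseq_window.
  by rewrite size_window// addn3.
(* The single colour [c] fixes the direction of every step, so the deltas are monotone. *)
have color_lt i : i.+2 < size s ->
    (c < q) = (nth 0 (deltas s) i < nth 0 (deltas s) i.+1).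
  move=> hi; rewrite -(color i hi) /phi /= deltas_take_drop.
  have : size (take 2 (drop i (deltas s))) = 2.
    by rewrite size_window// size_deltas; lia.
  have := @nth_window (deltas s) 2 i 0 isT.
  have := @nth_window (deltas s) 2 i 1 isT.
  case: (take _ _) => [|a [|b []]] //=; rewrite addn1 addn0 andbT => <- <- _.
  by case: ifP => _; rewrite ?chiq// ltnNge leq_addr.
have mono_d : if c < q then sorted ltn (deltas s) else sorted gtn (deltas s).
  case: ifP => cq; apply/(sortedP 0) => i; rewrite size_deltas => hi /=.
    by rewrite -color_lt//; lia.
  have hi' : i.+2 < size s by lia.
  have := color_lt i hi'; have := deltas_neq ss hi'; rewrite cq; lia.
case: ifP mono_d => cq mono_d.
  have [u [us uk ut]] := ramsey_free_inc c (isT : 0 < 2) N0 free ss sN ns mono_d.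
  by rewrite -(mono u us uk) /phi /= ut.
have [u [us uk ut]] := ramsey_free_dec (c - q) (isT : 0 < 2) N0 free ss sN ns mono_d.
apply; rewrite -(mono u us uk) /phi /=.
case: ifP => [|_]; last by rewrite addKn.
have : size (deltas u) = 2 by rewrite size_deltas uk.
by case: (deltas u) ut => [|a [|b []]] //=; rewrite !andbT; lia.
Qed.

(** Unless the first [n] entries are sorted for [r'], one of their steps satisfies [r]; the second
    hypothesis propagates [r] to all later steps, hence through the next [n] entries. *)
Lemma monotone_run (r r' : rel nat) d n :
    (forall i, i.+1 < 2 * n ->
       r (nth 0 d i) (nth 0 d i.+1) || r' (nth 0 d i) (nth 0 d i.+1)) ->
    (forall i, i.+2 < 2 * n -> r (nth 0 d i) (nth 0 d i.+1) ->
       r (nth 0 d i.+1) (nth 0 d i.+2)) ->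
    2 * n <= size d ->
  exists2 i, i + n <= 2 * n &
    sorted r (take n (drop i d)) \/ sorted r' (take n (drop i d)).
Proof.
move=> tot conv nd.
have [dec|/(sortedP 0)] := boolP (sorted r' (take n (drop 0 d))).
  by exists 0; [lia | right].
rewrite size_window; last lia.
move=> /existsNP[i /not_implyP[hi]]; rewrite !nth_window ?add0n; try lia.
move=> /negP nri; exists n; [lia | left].
have up j : i <= j -> j.+1 < 2 * n -> r (nth 0 d j) (nth 0 d j.+1).
  elim: j => [|j IHj] ij jn.
    by have := tot i; rewrite (negPf nri) orbF; have -> : i = 0 by [lia]; apply.
  move: ij; rewrite leq_eqVlt => /predU1P[<-|ij].
    by have := tot i; rewrite (negPf nri) orbF; apply; lia.
  by apply: conv => //; apply: IHj; lia.
apply/(sortedP 0) => j; rewrite size_window; last lia.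
by move=> hj; rewrite !nth_window ?addnS; try lia; apply: up; lia.
Qed.

Lemma sorted_ltn_gtn_window d k i : i + k <= size d -> 2 < k ->
    let t := take k (drop i d) in
  sorted ltn t || sorted gtn t ->
  (nth 0 d i < nth 0 d i.+1) = (nth 0 d i.+1 < nth 0 d i.+2).
Proof.
move=> ik k3 /= /orP[] /(sortedP 0); rewrite size_window// => h;
  have := h 0; have := h 1; rewrite !nth_window ?addn0 ?addn1 ?addn2 /=; lia.
Qed.

(* Among the k-tuples of deltas that are not monotone, those starting with a
   local maximum get colour 1 and those starting with a local minimum colour 0,
   so a monochromatic set cannot have both. *)
Lemma ramsey_free_step k q N n chi : 2 < k -> 1 < q -> 0 < N ->
  ramsey_free k q N n chi ->
  exists phi, ramsey_free k.+1 q (2 ^ N) (2 * n + k) phi.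
Proof.
move=> k3 q2 N0 free; have [chiq _] := free; have k0 : 0 < k by lia.
pose phi s := let d := deltas s in
  if sorted ltn d then chi d else if sorted gtn d then chi (rev d)
  else (nth 0 d 0 < nth 0 d 1) : nat.
exists phi; split=> [t|s c ss sN ns].
  rewrite /phi /=; do 2?case: ifP => // _; exact: leq_ltn_trans (leq_b1 _) q2.
apply: contrapT => /forallNP mono.
have {}mono u : subseq u s -> size u = k.+1 -> phi u = c.
  by move=> us u3; apply: contrapT => uc; apply: (mono u).
set d := deltas s.
(* The surplus [k] leaves room for a window of [k] deltas at every position examined among the first
   [2 * n]. *)
have sd : 2 * n + k <= (size d).+1 by rewrite size_deltas; lia.
have neq i : i.+1 < 2 * n -> nth 0 d i != nth 0 d i.+1.
  by move=> hi; apply: deltas_neq => //; lia.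
have turn i : i.+2 < 2 * n ->
    (nth 0 d i < nth 0 d i.+1) != (nth 0 d i.+1 < nth 0 d i.+2) ->
    c = (nth 0 d i < nth 0 d i.+1).
  move=> hi /eqP ne; have hk : i + k.+1 <= size s by lia.
  have : phi (take k.+1 (drop i s)) = c.
    by apply: mono; [exact: subseq_window | exact: size_window].
  rewrite /phi /= deltas_take_drop => <-.
  have := @sorted_ltn_gtn_window d k i; rewrite -/d => /(_ _ k3) /=.
  case: ifP => _ => [/(_ _ isT)h|]; first by case: ne; apply: h; lia.
  case: ifP => _ => [/(_ _ isT)h|_]; first by case: ne; apply: h; lia.
  by rewrite !nth_window ?addn0 ?addn1; lia.
have [i hi run] : exists2 i, i + n <= 2 * n &
    sorted ltn (take n (drop i d)) \/ sorted gtn (take n (drop i d)).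
  have nd : 2 * n <= size d by lia.
  (* Colour 1 excludes local minima, so descents persist; any other colour excludes local maxima, so
     ascents persist. *)
  have [c1|c0] := eqVneq c 1.
    have [||i hi run] := @monotone_run gtn ltn d n _ _ nd; last first.
    - by exists i => //; case: run; [right|left].
    - move=> i hi /= lt1; have := turn i hi; have := neq i.+1 hi; rewrite c1; lia.
    - move=> i hi /=; have := neq i hi; lia.
  apply: monotone_run => // i hi /=; first by have := neq i hi; lia.
  move=> lt1; have := turn i hi; have := neq i.+1 hi; lia.
have ss' : sorted ltn (take n.+1 (drop i s)).
  exact: (subseq_sorted ltn_trans (subseq_window _ _ _) ss).
have sN' : all (fun x => x < 2 ^ N) (take n.+1 (drop i s)).
  by apply/allP => x /(mem_subseq (subseq_window _ _ _)) xs; apply: (allP sN).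
have ns' : n < size (take n.+1 (drop i s)) by rewrite size_window//; lia.
rewrite /d -deltas_take_drop in run; case: run => run.
  have [u [us uk ut]] := ramsey_free_inc c k0 N0 free ss' sN' ns' run.
  apply; rewrite -(mono u (subseq_trans us (subseq_window _ _ _)) uk) /phi /=.
  by rewrite ut.
have [u [us uk ut]] := ramsey_free_dec c k0 N0 free ss' sN' ns' run.
apply; rewrite -(mono u (subseq_trans us (subseq_window _ _ _)) uk) /phi /=.
(* A decreasing list of this length is not increasing, so [phi] takes its second branch. *)
have : 2 < size (deltas u) by rewrite size_deltas uk.
rewrite ut; case: (deltas u) ut => [|a [|b w]] //= /andP[ab _] _.
by rewrite [a < b]ltnNge ltnW.
Qed.

Lemma ramsey_free_leq k q N n n' chi : n <= n' ->
  ramsey_free k q N n chi -> ramsey_free k q N n' chi.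
Proof.
by move=> nn' [chiq free]; split=> // s c ss sN /(leq_trans nn'); apply: free.
Qed.

(** * Random colourings *)

(** The [k]-subsets of [S] have their colour forced; all other sets, of any size, are coloured
    freely. *)
Lemma card_monochromatic (T : finType) k b (S : {set T}) :
  #|[set chi | monochromatic k chi b S]| * 2 ^ 'C(#|S|, k) = 2 ^ #|{set T}|.
Proof.
pose E := [set e : {set T} | e \subset S & #|e| == k].
pose F (e : {set T}) := if e \in E then pred1 b else predT.
have -> : #|[set chi | monochromatic k chi b S]| = #|family F|.
  apply: eq_card => chi; rewrite inE; apply/forallP/familyP => h e.
    by have := h e; rewrite /F inE; case: ifP.
  by have := h e; rewrite /F inE; case: ifP.
rewrite -cards_draws -/E card_family foldrE big_image /=.
rewrite -!prod_nat_const [X in _ * X]big_mkcond -big_split /=.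
 apply: eq_bigr => e _.
by rewrite /F; case: ifP => _; rewrite ?card1 // muln1 -card_bool; apply: eq_card.
Qed.

(** Union bound over the pairs of an [n]-set and a colour. *)
Lemma exists_chi_not_monochromatic (T : finType) k n :
    'C(#|T|, n) * 2 < 2 ^ 'C(n, k) ->
  exists chi : {ffun {set T} -> bool},
    forall b (S : {set T}), #|S| = n -> ~~ monochromatic k chi b S.
Proof.
move=> few; apply: contrapT => /forallNP bad.
pose D := [set p : {set T} * bool | #|p.1| == n].
have cD : #|D| = 'C(#|T|, n) * 2.
  rewrite -card_draws -card_bool -cardsT -cardsX; apply: eq_card => -[S b].
  by rewrite !inE andbT.
pose M (p : {set T} * bool) := [set chi | monochromatic k chi p.2 p.1].
have cover : 2 ^ #|{set T}| <= \sum_(p in D) #|M p|.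
  rewrite -card_bool -card_ffun -sum1_card.
  under [leqRHS]eq_bigr do rewrite -sum1_card big_mkcond.
  rewrite exchange_big; apply: leq_sum => chi _ /=.
  have /existsNP[b /existsNP[S /not_implyP[cS /negP/negPn mS]]] := bad chi.
  by rewrite (bigD1 (S, b)) ?inE /= ?mS// cS.
suff : 2 ^ #|{set T}| * 2 ^ 'C(n, k) <= 2 ^ #|{set T}| * ('C(#|T|, n) * 2).
  by rewrite leq_pmul2l ?expn_gt0// leqNgt few.
apply: (@leq_trans ((\sum_(p in D) #|M p|) * 2 ^ 'C(n, k))).
  by rewrite leq_mul2r cover orbT.
rewrite big_distrl /= -cD mulnC -sum_nat_const; apply: leq_sum => -[S b].
by rewrite inE => /eqP /= <-; rewrite card_monochromatic.
Qed.

Lemma sorted_val_enum N (A : {set 'I_N}) : sorted ltn (map val (enum A)).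
Proof.
apply: (subseq_sorted ltn_trans _ (iota_ltn_sorted 0 N)).
by rewrite -val_enum_ord map_subseq// {1}enumT filter_subseq.
Qed.

Lemma val_enum_mem N (s : seq nat) : sorted ltn s -> all (fun x => x < N) s ->
  map val (enum [set x : 'I_N | val x \in s]) = s.
Proof.
move=> ss sN; apply: (irr_sorted_eq ltn_trans ltnn) => //.
  exact: sorted_val_enum.
move=> x; apply/mapP/idP => [[y]|xs]; first by rewrite mem_enum inE => ? ->.
by exists (Ordinal (allP sN x xs)) => //; rewrite mem_enum inE.
Qed.

Lemma subseq_val_enum N (A B : {set 'I_N}) : A \subset B ->
  subseq (map val (enum A)) (map val (enum B)).
Proof.
move=> /subsetP AB; apply: map_subseq.
have -> : enum A = filter (mem A) (enum B).
  rewrite [enum B]/enum_mem -filter_predI; apply: eq_filter => x /=.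
  by rewrite andb_idr//; apply: AB.
exact: filter_subseq.
Qed.

Lemma ramsey_free_erdos k N n : 'C(N, n) * 2 < 2 ^ 'C(n, k) ->
  exists chi, ramsey_free k 2 N n chi.
Proof.
rewrite -{1}[N]card_ord => /exists_chi_not_monochromatic[f fP].
exists (fun t => f [set x : 'I_N | val x \in t]); split=> [t|s c ss sN ns].
  exact: (leq_ltn_trans (leq_b1 _)).
have tss := take_subseq s n.
have eS : map val (enum [set x : 'I_N | val x \in take n s]) = take n s.
  apply: val_enum_mem; first exact: (subseq_sorted ltn_trans tss).
  by apply/allP => x /(mem_subseq tss) xs; apply: (allP sN).
have cS : #|[set x : 'I_N | val x \in take n s]| = n.
  by rewrite cardE -(size_map val) eS size_takel.
(* Every [c] other than 1 is treated as blue; the edge found is then red, of colour 1. *)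
have /forallPn[e] := fP (c == 1) _ cS.
rewrite negb_imply => /andP[/andP[eS' /eqP ck] fe].
exists (map val (enum e)); split.
- by apply: subseq_trans tss; rewrite -eS; apply: subseq_val_enum.
- by rewrite size_map -cardE.
have -> : [set x : 'I_N | val x \in map val (enum e)] = e.
  by apply/setP => x; rewrite inE (mem_map val_inj) mem_enum.
by move=> fc; move: fe; rewrite -fc; case: (f e).
Qed.

Lemma bin_leq_expn N n : 'C(N, n) <= N ^ n.
Proof.
apply: (@leq_trans (N ^_ n)).
  by rewrite -bin_ffact leq_pmulr// fact_gt0.
elim: n => // n IHn; rewrite ffactnSr expnSr.
by apply: leq_mul => //; apply: leq_subr.
Qed.

(** For [n = 2 * m + 3] the binomial ['C(n, 2)] equals [n * (m + 1)], which exceeds the exponent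
    [m * n + 1] of the union bound. *)
Lemma ramsey_free_graph m : exists chi, ramsey_free 2 2 (2 ^ m) (2 * m + 3) chi.
Proof.
apply: ramsey_free_erdos.
apply: (@leq_ltn_trans ((2 ^ m) ^ (2 * m + 3) * 2)).
  by rewrite leq_mul2r bin_leq_expn orbT.
rewrite -expnM -expnSr ltn_exp2l// bin2 /=.
have -> : (2 * m + 3) * (2 * m + 3).-1 = ((2 * m + 3) * m.+1).*2 by rewrite -mul2n; lia.
rewrite doubleK; nia.
Qed.

(** The first step doubles two colours to four; later steps keep four. Each step exponentiates the
    number of vertices, while the forbidden size stays linear in [m]. *)
Lemma ramsey_free_tower k : 2 < k -> exists C, forall m,
  exists chi, ramsey_free k 4 (iter k.-1 (expn 2) m) (C * m.+1) chi.
Proof.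
elim: k => // k IHk; rewrite ltnS leq_eqVlt => /predU1P[<-|k2].
  exists 4 => m; have [chi free] := ramsey_free_graph m.
  have [|phi phiP] := ramsey_free_step2 _ free; first by rewrite expn_gt0.
  by exists phi; apply: ramsey_free_leq phiP; lia.
have [C hC] := IHk k2; exists (2 * C + k) => m.
have [chi free] := hC m.
have [|phi phiP] := ramsey_free_step k2 (isT : 1 < 4) _ free.
  by case: k k2 {IHk hC free} => [|[|k]] //= _; rewrite expn_gt0.
exists phi.
have -> : iter k.+1.-1 (expn 2) m = 2 ^ iter k.-1 (expn 2) m.
  by case: k k2 {IHk hC free phiP}.
apply: ramsey_free_leq phiP; nia.
Qed.

(** * From four colours to red and blue *)

Lemma behead_window (s : seq nat) j i :
  behead (take j.+1 (drop i s)) = take j (drop i.+1 s).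
Proof. by rewrite -[i.+1]add1n -drop_drop drop1; case: (drop i s). Qed.

(* A red set of [j + q] vertices contains a tight path of [q] red edges, along
   which [chi] takes [q + 1] increasing values. *)
Lemma no_increasing_tight_path j q chi (s : seq nat) :
  (forall t, chi t < q) -> j + q <= size s ->
  ~ forall t, subseq t s -> size t = j.+1 -> chi (take j t) < chi (behead t).
Proof.
move=> chiq js inc.
suff chi_ge i : i <= q -> i <= chi (take j (drop i s)).
  by have := chiq (take j (drop q s)); rewrite ltnNge chi_ge.
elim: i => // i IHi iq; apply: leq_ltn_trans (IHi (ltnW iq)) _.
rewrite -(take_takel _ (leqnSn j)) -behead_window; apply: inc.
  exact: subseq_window.
by rewrite size_window//; lia.
Qed.

(** The condition that a blue set imposes on [chi]. *)
Definition nonincreasing_on j (chi : seq nat -> nat) (s : seq nat) :=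
  forall t, subseq t s -> size t = j.+1 -> chi (behead t) <= chi (take j t).

(** Slide a window of length [j] from [e] to [f]; [chi] does not increase at any shift. *)
Lemma nonincreasing_on_cat j chi e f : nonincreasing_on j chi (e ++ f) ->
  size e = j -> size f = j -> chi f <= chi e.
Proof.
move=> dec se sf.
suff chi_le i : i <= j -> chi (take j (drop i (e ++ f))) <= chi e.
  by have := chi_le j (leqnn j); rewrite drop_size_cat// take_oversize ?sf.
elim: i => [|i IHi] ij; first by rewrite drop0 take_size_cat.
apply: leq_trans (IHi (ltnW ij)).
rewrite -behead_window -(take_takel _ (leqnSn j)); apply: dec.
  exact: subseq_window.
by rewrite size_window// size_cat; lia.
Qed.

(* Peel off a block of [n] vertices: it is not monochromatic in the top colour,
   so all later blocks avoid that colour. *)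
Lemma ramsey_free_nonincreasing j q N n chi c s : ramsey_free j q N n chi ->
    sorted ltn s -> all (fun x => x < N) s -> c.+1 * n <= size s ->
    (forall t, subseq t s -> size t = j -> chi t <= c) ->
  ~ nonincreasing_on j chi s.
Proof.
move=> [_ free]; elim: c s => [|c IHc] s ss sN ns chic dec.
  have [|t [ts tj t0]] := free s 0 ss sN; first by rewrite -[n]mul1n.
  by apply: t0; apply/eqP; rewrite -leqn0; apply: chic.
have [|||t [ts tj tc]] := free (take n s) c.+1.
- exact: (subseq_sorted ltn_trans (take_subseq s n)).
- by apply/allP => x /(mem_subseq (take_subseq s n)) xs; apply: (allP sN).
- by rewrite size_takel//; lia.
apply: (IHc (drop n s)).
- exact: (subseq_sorted ltn_trans (drop_subseq s n)).
- by apply/allP => x /(mem_subseq (drop_subseq s n)) xs; apply: (allP sN).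
- by rewrite size_drop; lia.
- move=> f fs fj; have tfs : subseq (t ++ f) s.
    by rewrite -(cat_take_drop n s) cat_subseq.
  have le_ft : chi f <= chi t.
    apply: (@nonincreasing_on_cat j) => // u us; apply: dec.
    exact: subseq_trans us tfs.
  have := chic t (subseq_trans ts (take_subseq s n)) tj.
  lia.
- by move=> u us; apply: dec; apply: subseq_trans us (drop_subseq s n).
Qed.

Lemma ramsey_gt_of_free j q N n m chi : 0 < q -> ramsey_free j q N n chi ->
  q * n <= m -> N < ramsey j.+1 (j + q) m.
Proof.
move=> q0 free nm; have [chiq _] := free.
rewrite /ramsey; case: ex_minnP => M hM _; rewrite ltnNge; apply/negP => MN.
pose col (e : {set 'I_M}) :=
  chi (take j (map val (enum e))) < chi (behead (map val (enum e))).
have colE (S : {set 'I_M}) b t :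
    monochromatic j.+1 [ffun e => col e] b S -> subseq t (map val (enum S)) ->
    size t = j.+1 -> (chi (take j t) < chi (behead t)) = b.
  move=> /forallP mono tS tj.
  have st : sorted ltn t.
    exact: (subseq_sorted ltn_trans tS (sorted_val_enum S)).
  have tM : all (fun x => x < M) t.
    by apply/allP => x /(mem_subseq tS)/mapP[y _ ->]; apply: ltn_ord.
  have := mono [set x : 'I_M | val x \in t].
  rewrite ffunE /col val_enum_mem// cardE -(size_map val) val_enum_mem//.
  rewrite tj eqxx andbT => /implyP h.
  rewrite (eqP (h _))//; apply/subsetP => x.
  by rewrite inE => /(mem_subseq tS); rewrite (mem_map val_inj) mem_enum.
have /forallP/(_ [ffun e => col e])/orP[] := hM => /existsP[S /andP[/eqP cS mono]].
  apply: (@no_increasing_tight_path j q chi (map val (enum S)) chiq).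
    by rewrite size_map -cardE cS.
  by move=> t tS tj; rewrite (colE S true).
apply: (@ramsey_free_nonincreasing j q N n chi q.-1 (map val (enum S))) => //.
- exact: sorted_val_enum.
- by apply/allP => x /mapP[y _ ->]; apply: leq_trans (ltn_ord y) MN.
- by rewrite size_map -cardE cS prednK.
- by move=> t _ _; rewrite -ltnS prednK.
- by move=> t tS tj; rewrite leqNgt (colE S false).
Qed.

(** * Real towers and the bound on s(k) *)

Local Open Scope ring_scope.

Lemma tower_natE (R : realType) i (m : nat) :
  tower i (m%:R : R) = (iter i.-1 (expn 2) m)%:R.
Proof.
rewrite /tower; elim: i.-1 => //= j ->.
by rewrite powR_mulrn// natrX.
Qed.

Lemma ler_tower (R : realType) i (x y : R) : x <= y -> tower i x <= tower i y.
Proof.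
move=> xy; rewrite /tower; elim: i.-1 => //= j IHj.
by rewrite ler_powR// ler1n.
Qed.

Lemma tower_growth_add3 (R : realType) (k : nat) : (4 <= k)%N ->
  tower_growth R k (k + 3).
Proof.
case: k => // k; rewrite ltnS => k3.
have [C hC] := ramsey_free_tower k3.
(* With [m + 1] the quotient of [n] by [D], [4 * C * (m + 1) <= n], so the blue bound applies; and
   [n < D * (m + 2) <= 3 * D * m] as [m >= 1], whence the constant. *)
pose D := (4 * C).+1; exists (3 * D)%:R^-1.
  by rewrite invr_gt0 ltr0n.
exists (2 * D)%N => n nD; pose m := (n %/ D).-1.
have m1 : (n %/ D)%N = m.+1 by rewrite prednK// divn_gt0//; lia.
have m0 : (0 < m)%N by have := leq_div2r D nD; rewrite mulnK// m1.
have [chi free] := hC m.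
(* Here [k] is one less than the uniformity, so [k.+1 + 3] is [k] plus the four colours. *)
have := @ramsey_gt_of_free k 4 _ _ n _ isT free; rewrite addSnnS => lt_r.
apply: (@le_trans _ _ (tower k (m%:R : R))).
  apply: ler_tower; rewrite mulrC ler_pdivrMr ?ltr0n// -natrM ler_nat.
  by have := ltn_ceil n (ltn0Sn (4 * C)); rewrite -/D m1; nia.
rewrite tower_natE ler_nat; apply/ltnW/lt_r.
by have := leq_trunc_div n D; rewrite m1 /D; nia.
Qed.

Theorem mainTheorem5 (R : realType) (k : nat) (hk : (4 <= k)%N) :
  exists2 m : nat, is_min_tower_growth R k m &
    m%:Z <= Num.ceil (5 / 2 * k%:R : R) - 3.
Proof.
have ex : exists s, `[< tower_growth R k s >].
  by exists (k + 3)%N; apply/asboolP/tower_growth_add3.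
case: (ex_minnP ex) => m /asboolP growth_m min_m; exists m.
  by split=> // s growth_s; apply: min_m; apply/asboolP.
have le_m : (m <= k + 3)%N by apply/min_m/asboolP/tower_growth_add3.
(* It suffices that [m + 3 <= 5 / 2 * k]; since [m <= k + 3], this follows from
   [k + 6 <= 5 / 2 * k], that is [4 <= k]. *)
rewrite lerBrDr -(intrKceil (R := R) (m%:Z + 3)).
apply: le_ceil.
have : (m%:R : R) <= k%:R + 3 by rewrite -[3]/(3%:R) -natrD ler_nat.
have : (4 : R) <= k%:R by rewrite -[4]/(4%:R) ler_nat.
rewrite intrD; lra.
Qed.
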